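(* Let $k,p$ be positive real numbers and $x\in\mathbb{C}\setminus k\mathbb{Z}^{-}$ with $\mathrm{Re}(x)>0$. Then $${}_{p}\Gamma_{k}(x)=\left(\frac{p}{k}\right)^{\frac{x}{k}}\Gamma_{k}(x)=\frac{p^{\frac{x}{k}}}{k}\,\Gamma\left(\frac{x}{k}\right).$$
   Context: $\mathbb{Z}^-$ is the set of negative integers and $\Gamma$ is the classical Gamma function. The p-k Pochhammer symbol is ${}_{p}(x)_{n,k}=\left(\frac{xp}{k}\right)\left(\frac{xp}{k}+p\right)\cdots\left(\frac{xp}{k}+(n-1)p\right)$, and the p-k Gamma function is, for $\mathrm{Re}(x)>0$, $${}_{p}\Gamma_{k}(x)=\frac1k\lim_{n\to\infty}\frac{n!\,p^{n+1}(np)^{x/k}}{{}_{p}(x)_{n+1,k}}=\frac1k\lim_{n\to\infty}\frac{n!\,p^{n+1}(np)^{\frac{x}{k}-1}}{{}_{p}(x)_{n,k}}.$$ The k-Gamma function (of Diaz and Pariguan) is $\Gamma_k(x)=\lim_{n\to\infty}\frac{n!\,k^{n}(nk)^{\frac{x}{k}-1}}{(x)_{n,k}}$, where $(x)_{n,k}=x(x+k)(x+2k)\cdots(x+(n-1)k)$. For a positive real base $c$, $c^{z}=e^{z\ln c}$. *)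

(* Defs.v *)
From Stdlib Require Import Reals ZArith Lra Lia.
From Coquelicot Require Export Coquelicot.

Local Open Scope C_scope.

Definition Cexp (z : C) : C :=
  (exp (Re z) * cos (Im z), exp (Re z) * sin (Im z))%R.

(* c ^ z = e ^ (z ln c); meaningful for a real base c > 0. *)
Definition Rcpower (c : R) (z : C) : C := Cexp (z * RtoC (ln c)).

(* u 0 * u 1 * ... * u (n - 1) *)
Fixpoint Cprod (u : nat -> C) (n : nat) : C :=
  match n with
  | O => 1
  | S m => Cprod u m * u m
  end.

Definition is_Clim_seq (u : nat -> C) (l : C) : Prop :=
  filterlim u eventually (@locally C_R_CompleteNormedModule l).

Definition ex_Clim_seq (u : nat -> C) : Prop := exists l, is_Clim_seq u l.

(* The limit of [u]; unspecified unless [ex_Clim_seq u]. *)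
Definition Clim_seq (u : nat -> C) : C :=
  @iota C_R_CompleteNormedModule (is_Clim_seq u).

Lemma is_Clim_seq_unique (u : nat -> C) (l : C) :
  is_Clim_seq u l -> Clim_seq u = l.
Proof.
intros Hl.
apply (@iota_unique R_AbsRing C_R_CompleteNormedModule); [|exact Hl].
intros y Hy.
exact (@filterlim_locally_unique nat R_AbsRing C_R_CompleteNormedModule
  eventually _ u y l Hy Hl).
Qed.

(* Euler's integral of the second kind, for Re z > 0. *)
Definition CGamma (z : C) : C :=
  @RInt_gen C_R_CompleteNormedModule
    (fun t : R => Rcpower t (z - 1) * RtoC (exp (- t)))
    (at_right 0) (Rbar_locally p_infty).

Definition k_pochhammer (k : R) (x : C) (n : nat) : C :=
  Cprod (fun i => x + RtoC (INR i * k)) n.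

Definition pk_pochhammer (p k : R) (x : C) (n : nat) : C :=
  Cprod (fun i => x * RtoC p / RtoC k + RtoC (INR i * p)) n.

Definition kGamma_seq (k : R) (x : C) (n : nat) : C :=
  RtoC (INR (fact n) * k ^ n) * Rcpower (INR n * k) (x / RtoC k - 1)
  / k_pochhammer k x n.

Definition kGamma (k : R) (x : C) : C := Clim_seq (kGamma_seq k x).

Definition pkGamma_seq (p k : R) (x : C) (n : nat) : C :=
  RtoC (INR (fact n) * p ^ (n + 1)) * Rcpower (INR n * p) (x / RtoC k)
  / pk_pochhammer p k x (n + 1).

Definition pkGamma (p k : R) (x : C) : C :=
  1 / RtoC k * Clim_seq (pkGamma_seq p k x).

(* The other sequence used to define the p-k Gamma function; it has the same
   limit as [pkGamma_seq], see [pkGamma_alt]. *)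
Definition pkGamma_seq' (p k : R) (x : C) (n : nat) : C :=
  RtoC (INR (fact n) * p ^ (n + 1)) * Rcpower (INR n * p) (x / RtoC k - 1)
  / pk_pochhammer p k x n.

Lemma Cexp_minus (z w : C) : Cexp w <> 0 /\ Cexp (z - w) = Cexp z / Cexp w.
Proof.
assert (E : forall a b, Cexp (a + b) = Cexp a * Cexp b).
{ intros [a1 a2] [b1 b2]; unfold Cexp, Cmult, Cplus; simpl.
  rewrite exp_plus, cos_plus, sin_plus; f_equal; ring. }
assert (E0 : Cexp 0 = 1).
{ unfold Cexp; simpl; rewrite exp_0, cos_0, sin_0.
  unfold RtoC; f_equal; ring. }
assert (Hw : Cexp w * Cexp (- w) = 1).
{ rewrite <- E, Cplus_opp_r; exact E0. }
assert (Hn : Cexp w <> 0).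
{ intros H; rewrite H, Cmult_0_l in Hw.
  apply (f_equal Re) in Hw; simpl in Hw; lra. }
split; [exact Hn|].
unfold Cminus; rewrite E.
replace (Cexp (- w)) with (/ Cexp w); [reflexivity|].
transitivity (/ Cexp w * (Cexp w * Cexp (- w))).
- rewrite Hw; ring.
- rewrite Cmult_assoc, Cinv_l; [ring | exact Hn].
Qed.

Lemma Rcpower_minus_1 (c : R) (z : C) :
  (0 < c)%R -> Rcpower c (z - 1) = Rcpower c z / RtoC c.
Proof.
intros Hc; unfold Rcpower.
replace ((z - 1) * RtoC (ln c)) with (z * RtoC (ln c) - RtoC (ln c)) by ring.
rewrite (proj2 (Cexp_minus _ _)).
replace (Cexp (RtoC (ln c))) with (RtoC c); [reflexivity|].
unfold Cexp; simpl; rewrite exp_ln, cos_0, sin_0 by exact Hc.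
unfold RtoC; f_equal; ring.
Qed.

Lemma is_Clim_seq_1_div (a : C) :
  is_Clim_seq (fun n => 1 + a * RtoC (/ INR n)) 1.
Proof.
assert (H : forall b : R, is_lim_seq (fun n => b * / INR n)%R 0).
{ intros b; replace (Finite 0) with (Rbar_mult b 0)
    by (simpl; f_equal; ring).
  apply is_lim_seq_scal_l.
  apply (is_lim_seq_inv INR p_infty); [apply is_lim_seq_INR | easy]. }
assert (H1 := is_lim_seq_plus' _ _ _ _ (is_lim_seq_const 1) (H (Re a))).
assert (H2 := H (Im a)).
rewrite Rplus_0_r in H1.
apply is_lim_seq_spec in H1; apply is_lim_seq_spec in H2.
unfold is_Clim_seq; apply filterlim_locally; intros eps.
specialize (H1 eps); specialize (H2 eps); simpl in H1, H2.
generalize (filter_and _ _ H1 H2); apply filter_imp; intros n [h1 h2].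
split; simpl; unfold ball; simpl; unfold AbsRing_ball, abs, minus, plus, opp;
  simpl.
- eapply Rle_lt_trans; [|exact h1]; right; f_equal.
  unfold Re; ring.
- eapply Rle_lt_trans; [|exact h2]; right; f_equal.
  unfold Im; ring.
Qed.

Lemma is_Clim_seq_mult_1 (u v w : nat -> C) (l : C) :
  (forall n, (0 < n)%nat -> w n = u n * v n) ->
  is_Clim_seq u l -> is_Clim_seq v 1 -> is_Clim_seq w l.
Proof.
intros Hw Hu Hv.
assert (Hl : l = mult (K := C_AbsRing) l (RtoC 1)) by (symmetry; apply Cmult_1_r).
intros P HP; rewrite Hl in HP.
apply (proj1 (locally_C _ _)) in HP.
assert (K : forall (s : nat -> C) (m : C), is_Clim_seq s m ->
  filterlim s eventually (@locally (AbsRing_UniformSpace C_AbsRing) m)).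
{ intros s m Hs Q HQ; apply Hs; apply (proj2 (locally_C _ _)); exact HQ. }
assert (E := filterlim_comp_2 _ _ _ (K _ _ Hu) (K _ _ Hv)
  (@filterlim_mult C_AbsRing l (RtoC 1)) P HP).
destruct E as [N HN]; exists (S N); intros n Hn.
rewrite Hw by lia; apply HN; lia.
Qed.

Lemma pk_pochhammer_neq_0 (p k : R) (x : C) (n : nat) :
  (0 < p)%R -> (0 < k)%R -> (0 < Re x)%R -> pk_pochhammer p k x n <> 0.
Proof.
intros Hp Hk Hx; unfold pk_pochhammer.
assert (Hs : (0 < Re x * p / k)%R).
{ apply Rdiv_lt_0_compat; [apply Rmult_lt_0_compat|]; assumption. }
assert (Hf : forall i, x * RtoC p / RtoC k + RtoC (INR i * p) <> 0).
{ intros i H; apply (f_equal Re) in H.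
  assert (Hi : (0 <= INR i * p)%R)
    by (apply Rmult_le_pos; [apply pos_INR | lra]).
  unfold Cdiv in H; rewrite <- RtoC_inv in H by lra.
  unfold Rdiv in Hs; destruct x as [a b]; simpl in H, Hs; lra. }
induction n as [|n IH]; simpl.
- intros H; apply (f_equal Re) in H; simpl in H; lra.
- apply Cmult_neq_0; [exact IH | apply Hf].
Qed.

Lemma pkGamma_alt (p k : R) (x : C) :
  (0 < p)%R -> (0 < k)%R -> (0 < Re x)%R ->
  ex_Clim_seq (pkGamma_seq p k x) ->
  pkGamma p k x = 1 / RtoC k * Clim_seq (pkGamma_seq' p k x).
Proof.
intros Hp Hk Hx [l Hl]; unfold pkGamma.
rewrite (is_Clim_seq_unique _ _ Hl); f_equal; symmetry.
apply is_Clim_seq_unique.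
refine (is_Clim_seq_mult_1 _ _ _ l _ Hl (is_Clim_seq_1_div (x / RtoC k))).
intros n Hn.
assert (Hn' : (0 < INR n)%R) by (apply lt_0_INR; exact Hn).
assert (P1 := pk_pochhammer_neq_0 p k x (n + 1) Hp Hk Hx).
assert (Hc : RtoC k <> 0) by (intros H; apply RtoC_inj in H; lra).
assert (Hq : RtoC p <> 0) by (intros H; apply RtoC_inj in H; lra).
assert (Hm : RtoC (INR n) <> 0) by (intros H; apply RtoC_inj in H; lra).
unfold pkGamma_seq, pkGamma_seq'.
rewrite Rcpower_minus_1 by (apply Rmult_lt_0_compat; assumption).
assert (P2 : pk_pochhammer p k x (n + 1) =
  pk_pochhammer p k x n * (x * RtoC p / RtoC k + RtoC (INR n * p))).
{ rewrite Nat.add_1_r; reflexivity. }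
rewrite P2 in P1 |- *.
assert (P3 : pk_pochhammer p k x n <> 0)
  by (intros H; apply P1; rewrite H; ring).
assert (P4 : x * RtoC p / RtoC k + RtoC (INR n * p) <> 0)
  by (intros H; apply P1; rewrite H; ring).
rewrite RtoC_inv, (RtoC_mult (INR n) p) by lra.
rewrite (RtoC_mult (INR n) p) in P4.
field; repeat split; try assumption.
intros H; apply P4.
transitivity ((x * RtoC p + RtoC (INR n) * RtoC p * RtoC k) / RtoC k);
  [field; assumption|].
first [rewrite H | fail]; unfold Cdiv; ring.
Qed.

(* Main.v *)
(* With z = x/k, scaling by p and k turns both sequences into Euler's sequence
   n! n^z / (z (z+1) ... (z+n)), which is \int_0^n t^(z-1) (1 - t/n)^n dt. Since
   0 <= e^(-t) - (1 - t/n)^n <= t^2 e^(-t) / n on [0, n], this integral differs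
   from \int_0^n t^(z-1) e^(-t) dt by O(1/n), so the limit is Gamma(z). *)
Require Import Defs.
From Stdlib Require Import Reals ZArith Lra Lia.
From Coquelicot Require Import Coquelicot.

Local Open Scope C_scope.

Local Notation CV := C_R_CompleteNormedModule.

(** * Modulus, nonvanishing and limits of complex sequences *)

(** The norm of a pair is the Euclidean one, up to absolute values under the squares. This is the
    bridge between the integration theory, stated with [norm], and computations with [Cmod]. *)
Lemma norm_Cmod (z : C) : @norm R_AbsRing CV z = Cmod z.
Proof.
destruct z as [a b]; unfold norm, Cmod; simpl.
unfold prod_norm, norm; simpl; unfold abs; simpl.
f_equal; rewrite !Rmult_1_r, <- !Rabs_mult.
f_equal; apply Rabs_pos_eq; apply Rle_0_sqr.
Qed.

Lemma RtoC_neq_0 (a : R) : (0 < a)%R -> RtoC a <> 0.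
Proof. intros Ha H; apply RtoC_inj in H; lra. Qed.

Lemma Cprod_neq_0 (u : nat -> C) (n : nat) :
  (forall i, u i <> 0) -> Cprod u n <> 0.
Proof.
intros H; induction n as [|n IH]; simpl.
- apply RtoC_neq_0, Rlt_0_1.
- apply Cmult_neq_0; [exact IH | apply H].
Qed.

Lemma is_Clim_seq_eps (u : nat -> C) (l : C) :
  (forall eps : posreal, eventually (fun n => (Cmod (u n - l) < eps)%R)) ->
  is_Clim_seq u l.
Proof.
intros H; apply (filterlim_locally_ball_norm (U := CV)); intros eps.
generalize (H eps); apply filter_imp; intros n Hn.
unfold ball_norm; rewrite norm_Cmod; exact Hn.
Qed.

Lemma is_Clim_seq_Cmod (u : nat -> C) (l : C) (eps : posreal) :
  is_Clim_seq u l -> eventually (fun n => (Cmod (u n - l) < eps)%R).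
Proof.
intros H; apply (filterlim_locally_ball_norm (U := CV)) with (eps := eps) in H.
revert H; apply filter_imp; intros n Hn.
unfold ball_norm in Hn; rewrite norm_Cmod in Hn; exact Hn.
Qed.

Lemma is_Clim_seq_scal (c : C) (u : nat -> C) (l : C) :
  is_Clim_seq u l -> is_Clim_seq (fun n => c * u n) (c * l).
Proof.
intros H; apply is_Clim_seq_eps; intros eps.
assert (Hc := Cmod_ge_0 c).
(* Dividing by [Cmod c + 1] rather than [Cmod c] covers [c = 0] as well. *)
assert (He : (0 < eps / (Cmod c + 1))%R)
  by (apply Rdiv_lt_0_compat; [apply eps | lra]).
generalize (is_Clim_seq_Cmod _ _ (mkposreal _ He) H); apply filter_imp.
intros n Hn; simpl in Hn.
replace (c * u n - c * l) with (c * (u n - l)) by ring.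
rewrite Cmod_mult.
apply Rle_lt_trans with ((Cmod c + 1) * Cmod (u n - l))%R.
- apply Rmult_le_compat_r; [apply Cmod_ge_0 | lra].
- apply Rmult_lt_compat_l with (r := (Cmod c + 1)%R) in Hn; [|lra].
  replace ((Cmod c + 1) * (eps / (Cmod c + 1)))%R with (eps : R) in Hn
    by (field; lra).
  exact Hn.
Qed.

(** * Complex powers of a real base *)

Lemma Cexp_plus (z w : C) : Cexp (z + w) = Cexp z * Cexp w.
Proof.
destruct z as [a b], w as [c d]; unfold Cexp, Cmult, Cplus; simpl.
rewrite exp_plus, cos_plus, sin_plus; f_equal; ring.
Qed.

Lemma Rcpower_mult_base (a b : R) (z : C) :
  (0 < a)%R -> (0 < b)%R -> Rcpower (a * b) z = Rcpower a z * Rcpower b z.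
Proof.
intros Ha Hb; unfold Rcpower; rewrite ln_mult, <- Cexp_plus by assumption.
f_equal; rewrite RtoC_plus; ring.
Qed.

Lemma Rcpower_split (t : R) (z : C) :
  (0 < t)%R -> Rcpower t z = Rcpower t (z - 1) * RtoC t.
Proof.
intros Ht; rewrite Rcpower_minus_1 by exact Ht.
field; intros H; apply RtoC_inj in H; lra.
Qed.

Lemma Rcpower_polar (t : R) (z : C) :
  Rcpower t z = (exp (Re z * ln t) * cos (Im z * ln t),
                 exp (Re z * ln t) * sin (Im z * ln t))%R.
Proof.
destruct z as [a b]; unfold Rcpower, Cexp; simpl.
replace (a * ln t - b * 0)%R with (a * ln t)%R by ring.
replace (a * 0 + b * ln t)%R with (b * ln t)%R by ring.
reflexivity.
Qed.

(** The imaginary part of the exponent only contributes a phase. Real powers t^(Re z) are written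
    [exp (Re z * ln t)] in all the bounds that follow. *)
Lemma Cmod_Rcpower (t : R) (z : C) :
  Cmod (Rcpower t z) = exp (Re z * ln t).
Proof.
rewrite Rcpower_polar; unfold Cmod; simpl.
set (r := exp _); set (y := (Im z * ln t)%R).
replace (_ + _)%R with (r * r)%R.
- apply sqrt_square, Rlt_le, exp_pos.
- assert (H := sin2_cos2 y); unfold Rsqr in H.
  transitivity (r * r * (sin y * sin y + cos y * cos y))%R; [rewrite H; ring|].
  ring.
Qed.

Lemma Cmod_Rcpower_mult (t r : R) (z : C) :
  Cmod (Rcpower t z * RtoC r) = (exp (Re z * ln t) * Rabs r)%R.
Proof. rewrite Cmod_mult, Cmod_Rcpower, Cmod_R; reflexivity. Qed.

(** * Differentiation of complex functions of a real variable *)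

(** Write f as Re f * 1 + Im f * i, a combination of two fixed vectors with real differentiable
    coefficients. *)
Lemma is_derive_pair (f : R -> C) (t : R) (l : C) :
  is_derive (fun s => Re (f s)) t (Re l) ->
  is_derive (fun s => Im (f s)) t (Im l) ->
  @is_derive R_AbsRing CV f t l.
Proof.
intros H1 H2.
assert (H3 := is_derive_scal_l (V := CV) _ _ _ (RtoC 1) H1).
assert (H4 := is_derive_scal_l (V := CV) _ _ _ Ci H2).
assert (H5 := is_derive_plus (V := CV) _ _ _ _ _ H3 H4).
assert (E : forall w : C, @plus CV
  (@scal R_AbsRing CV (Re w) (RtoC 1)) (@scal R_AbsRing CV (Im w) Ci) = w).
{ intros [a b]; unfold plus, scal; simpl; unfold prod_plus, prod_scal; simpl.
  unfold plus, scal; simpl; unfold mult; simpl; f_equal; ring. }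
rewrite E in H5.
eapply is_derive_ext; [|exact H5]; intros s; apply E.
Qed.

Lemma is_derive_Re (f : R -> C) (t : R) (l : C) :
  @is_derive R_AbsRing CV f t l -> is_derive (fun s => Re (f s)) t (Re l).
Proof.
intros H.
apply (filterdiff_comp' (U := R_NormedModule) (V := C_R_NormedModule)
  (W := R_NormedModule) f (fun w => fst w) t (fun y => scal y l)
  (fun w => fst w) H).
apply filterdiff_linear, is_linear_fst.
Qed.

Lemma is_derive_Im (f : R -> C) (t : R) (l : C) :
  @is_derive R_AbsRing CV f t l -> is_derive (fun s => Im (f s)) t (Im l).
Proof.
intros H.
apply (filterdiff_comp' (U := R_NormedModule) (V := C_R_NormedModule)
  (W := R_NormedModule) f (fun w => snd w) t (fun y => scal y l)
  (fun w => snd w) H).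
apply filterdiff_linear, is_linear_snd.
Qed.

Lemma is_derive_Cmult (f g : R -> C) (t : R) (lf lg : C) :
  @is_derive R_AbsRing CV f t lf -> @is_derive R_AbsRing CV g t lg ->
  @is_derive R_AbsRing CV (fun s => f s * g s) t (lf * g t + f t * lg).
Proof.
intros Hf Hg.
assert (F1 := is_derive_Re _ _ _ Hf); assert (F2 := is_derive_Im _ _ _ Hf).
assert (G1 := is_derive_Re _ _ _ Hg); assert (G2 := is_derive_Im _ _ _ Hg).
assert (M := fun u v a b (Hu : is_derive u t a) (Hv : is_derive v t b) =>
  is_derive_mult u v t a b Hu Hv Rmult_comm).
apply is_derive_pair.
- assert (D := is_derive_minus _ _ _ _ _ (M _ _ _ _ F1 G1) (M _ _ _ _ F2 G2)).
  eapply eq_ind; [exact D|].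
  unfold minus, plus, opp, mult; simpl; unfold Re, Im; ring.
- assert (D := is_derive_plus _ _ _ _ _ (M _ _ _ _ F1 G2) (M _ _ _ _ F2 G1)).
  eapply eq_ind; [exact D|].
  unfold minus, plus, opp, mult; simpl; unfold Re, Im; ring.
Qed.

Lemma is_derive_Cplus (f g : R -> C) (t : R) (lf lg : C) :
  @is_derive R_AbsRing CV f t lf -> @is_derive R_AbsRing CV g t lg ->
  @is_derive R_AbsRing CV (fun s => f s + g s) t (lf + lg).
Proof. exact (is_derive_plus (V := CV) f g t lf lg). Qed.

Lemma is_derive_RtoC (r : R -> R) (t l : R) :
  is_derive r t l -> @is_derive R_AbsRing CV (fun s => RtoC (r s)) t (RtoC l).
Proof.
intros H; apply is_derive_pair; [exact H | exact (is_derive_const 0 t)].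
Qed.

Lemma is_derive_Rcpower (t : R) (z : C) :
  (0 < t)%R ->
  @is_derive R_AbsRing CV (fun s => Rcpower s z) t (z * Rcpower t (z - 1)).
Proof.
intros Ht.
(* Differentiating the polar form produces z t^z / t, so the claimed derivative is first put in that
   shape. *)
assert (E : z * Rcpower t (z - 1) = z * Rcpower t z / RtoC t)
  by (rewrite Rcpower_minus_1 by exact Ht; unfold Cdiv; ring).
unfold Cdiv in E; rewrite <- RtoC_inv in E by lra.
rewrite E, Rcpower_polar; apply is_derive_pair.
- apply is_derive_ext with (fun s => exp (Re z * ln s) * cos (Im z * ln s))%R.
  { intros s; rewrite Rcpower_polar; reflexivity. }
  auto_derive; [repeat split; assumption|].
  destruct z; simpl; field; lra.
- apply is_derive_ext with (fun s => exp (Re z * ln s) * sin (Im z * ln s))%R.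
  { intros s; rewrite Rcpower_polar; reflexivity. }
  auto_derive; [repeat split; assumption|].
  destruct z; simpl; field; lra.
Qed.

Lemma continuous_Rcpower_mult (r : R -> R) (t : R) (w : C) :
  (0 < t)%R -> ex_derive r t ->
  @continuous R_UniformSpace CV (fun s => Rcpower s w * RtoC (r s)) t.
Proof.
intros Ht [l Hl]; apply (ex_derive_continuous (V := CV)).
eexists; apply is_derive_Cmult;
  [apply is_derive_Rcpower, Ht | apply is_derive_RtoC, Hl].
Qed.

(** * The primitive of Euler's integrand *)

(* t |-> \int_0^t s^(z-1) (1 - s/N)^j ds; the recursion in j is integration by
   parts. *)
Fixpoint euler_primitive (N : R) (z : C) (j : nat) (t : R) : C :=
  match j with
  | O => Rcpower t z / z
  | S i => (Rcpower t z * RtoC ((1 - t / N) ^ S i)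
            + RtoC (INR (S i)) * euler_primitive N z i t)
           / (z + RtoC (INR (S i)))
  end.

Lemma Cplus_INR_neq_0 (z : C) (n : nat) :
  (0 < Re z)%R -> z + RtoC (INR n) <> 0.
Proof.
intros Hz H; apply (f_equal Re) in H; simpl in H.
assert (Hn := pos_INR n); unfold Re in Hz; lra.
Qed.

(** Induction on [j]. The derivative of t^z (1 - t/N)^(j+1), plus j+1 times the previous integrand,
    is t^(z-1) (1 - t/N)^j times z (1 - t/N) - (j+1) t/N + (j+1), which is (z+j+1) (1 - t/N). The
    denominator in the recursion cancels z+j+1. *)
Lemma is_derive_euler_primitive (N t : R) (z : C) (j : nat) :
  (0 < N)%R -> (0 < t)%R -> (0 < Re z)%R ->
  @is_derive R_AbsRing CV (euler_primitive N z j) t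
    (Rcpower t (z - 1) * RtoC ((1 - t / N) ^ j)).
Proof.
intros HN Ht Hz.
assert (Hz0 : z <> 0).
{ intros H; rewrite H in Hz; simpl in Hz; lra. }
assert (DE := is_derive_Rcpower t z Ht).
assert (DC : forall c : C, @is_derive R_AbsRing CV (fun _ => c) t (RtoC 0))
  by (intros c; exact (is_derive_const (V := CV) c t)).
induction j as [|j IH].
- assert (D := is_derive_Cmult _ _ _ _ _ DE (DC (/ z))).
  eapply eq_ind; [exact D|]; simpl; field; exact Hz0.
- assert (DR : is_derive (fun s => (1 - s / N) ^ S j)%R t
    (- (INR (S j) / N * (1 - t / N) ^ j))%R).
  { auto_derive; [exact I|].
    change (match j with O => 1 | S _ => INR j + 1 end)%R with (INR (S j)).
    unfold Rdiv, Rminus; ring. }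
  assert (D1 := is_derive_Cmult _ _ _ _ _ DE (is_derive_RtoC _ _ _ DR)).
  assert (D2 := is_derive_Cmult _ _ _ _ _ (DC (RtoC (INR (S j)))) IH).
  assert (D3 := is_derive_Cplus _ _ _ _ _ D1 D2).
  assert (D4 := is_derive_Cmult _ _ _ _ _ D3
    (DC (/ (z + RtoC (INR (S j)))))).
  refine (eq_ind _ (fun w : C => @is_derive R_AbsRing CV _ t w) D4 _ _).
  (* With t^z written as t^(z-1) t, only one power of t is left, and [field] can treat it as an
     atom. *)
  rewrite (Rcpower_split t z Ht).
  cbv beta.
  assert (Hq := Cplus_INR_neq_0 z (S j) Hz).
  assert (HNC := RtoC_neq_0 N HN).
  rewrite RtoC_opp, RtoC_mult, (RtoC_div (INR (S j)) N) by lra.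
  simpl pow; rewrite RtoC_mult, RtoC_minus, RtoC_div by lra.
  field; split; assumption.
Qed.

(** At t = N the boundary term vanishes, so each step of the recursion only multiplies by
    (j+1)/(z+j+1). The initial 1/z accounts for the extra factor in the product. For N = j = n this
    is the n-th term of Euler's sequence. *)
Lemma euler_primitive_end (N : R) (z : C) (j : nat) :
  (0 < N)%R -> (0 < Re z)%R ->
  euler_primitive N z j N =
  RtoC (INR (fact j)) * Rcpower N z / Cprod (fun i => z + RtoC (INR i)) (S j).
Proof.
intros HN Hz.
induction j as [|j IH].
- assert (H := Cplus_INR_neq_0 z 0 Hz); simpl in H |- *.
  field; intros E; apply H; rewrite E; ring.
- change (euler_primitive N z (S j) N) with
    ((Rcpower N z * RtoC ((1 - N / N) ^ S j)
      + RtoC (INR (S j)) * euler_primitive N z j N)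
     / (z + RtoC (INR (S j)))).
  rewrite IH.
  replace (1 - N / N)%R with 0%R by (field; lra).
  rewrite pow_i by lia.
  change (fact (S j)) with (S j * fact j)%nat.
  rewrite mult_INR, RtoC_mult.
  change (Cprod (fun i => z + RtoC (INR i)) (S (S j))) with
    (Cprod (fun i => z + RtoC (INR i)) (S j) * (z + RtoC (INR (S j)))).
  field; split; [|apply (Cprod_neq_0 _ (S j)); intros i]; apply Cplus_INR_neq_0, Hz.
Qed.

(** Every term of the recursion carries a factor t^z, hence the primitive tends to 0 at 0+. [K] may
    depend on [N] and [j], because the lower endpoint of integration will be chosen after them. *)
Lemma euler_primitive_bound (N : R) (z : C) (j : nat) :
  (0 < N)%R -> (0 < Re z)%R ->
  exists K : R, (0 <= K)%R /\ forall t : R, (0 < t <= N)%R ->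
    (Cmod (euler_primitive N z j t) <= K * exp (Re z * ln t))%R.
Proof.
intros HN Hz; induction j as [|j [K [HK IH]]].
- assert (Hz0 : z <> 0).
  { intros H; rewrite H in Hz; simpl in Hz; lra. }
  exists (/ Cmod z)%R; split.
  { apply Rlt_le, Rinv_0_lt_compat, Cmod_gt_0, Hz0. }
  intros t _; simpl; rewrite Cmod_div, Cmod_Rcpower by exact Hz0.
  right; unfold Rdiv; ring.
- assert (Hq := Cplus_INR_neq_0 z (S j) Hz).
  set (q := z + RtoC (INR (S j))) in *.
  assert (Hq' : (0 < / Cmod q)%R)
    by (apply Rinv_0_lt_compat, Cmod_gt_0, Hq).
  exists ((1 + INR (S j) * K) * / Cmod q)%R; split.
  { apply Rmult_le_pos; [|lra].
    assert (H := Rmult_le_pos _ _ (pos_INR (S j)) HK); lra. }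
  intros t Ht.
  change (euler_primitive N z (S j) t) with
    ((Rcpower t z * RtoC ((1 - t / N) ^ S j)
      + RtoC (INR (S j)) * euler_primitive N z j t) / q).
  rewrite Cmod_div by exact Hq.
  replace ((1 + INR (S j) * K) * / Cmod q * exp (Re z * ln t))%R with
    ((exp (Re z * ln t) + INR (S j) * (K * exp (Re z * ln t))) * / Cmod q)%R
    by ring.
  apply Rmult_le_compat_r; [lra|].
  eapply Rle_trans; [apply Cmod_triangle|].
  apply Rplus_le_compat.
  + rewrite Cmod_Rcpower_mult.
    apply Rle_trans with (exp (Re z * ln t) * 1)%R; [|right; ring].
    apply Rmult_le_compat_l; [apply Rlt_le, exp_pos|].
    assert (H : (0 <= t / N <= 1)%R).
    { split; [apply Rlt_le, Rdiv_lt_0_compat; lra|].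
      apply Rle_div_l; lra. }
    rewrite <- RPow_abs; eapply Rle_trans; [|right; apply (pow1 (S j))].
    apply pow_incr; split; [apply Rabs_pos | apply Rabs_le; lra].
  + rewrite Cmod_mult, Cmod_R, Rabs_pos_eq by apply pos_INR.
    apply Rmult_le_compat_l; [apply pos_INR | apply IH, Ht].
Qed.

(** * Integral and exponential inequalities *)

Local Open Scope R_scope.

Lemma is_RInt_eq (f : R -> CV) (a b : R) (l l' : CV) :
  is_RInt f a b l -> is_RInt f a b l' -> l = l'.
Proof.
intros H H'.
exact (eq_trans (eq_sym (is_RInt_unique f a b l H)) (is_RInt_unique f a b l' H')).
Qed.

Lemma exp_le (u v : R) : u <= v -> exp u <= exp v.
Proof.
intros [H|H]; [apply Rlt_le, exp_increasing, H | rewrite H; apply Rle_refl].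
Qed.

(** The integral of the majorant is read off its primitive [G]. The absolute value allows endpoints
    in either order, which a Cauchy argument on moving endpoints requires. *)
Lemma is_RInt_norm_le_primitive (f : R -> CV) (G g : R -> R) (a b : R) (l : CV) :
  (forall t, Rmin a b <= t <= Rmax a b ->
     norm (f t) <= g t /\ is_derive G t (g t) /\ continuous g t) ->
  is_RInt f a b l -> norm l <= Rabs (G b - G a).
Proof.
assert (W : forall a b l, a <= b ->
  (forall t, Rmin a b <= t <= Rmax a b ->
     norm (f t) <= g t /\ is_derive G t (g t) /\ continuous g t) ->
  is_RInt f a b l -> norm l <= G b - G a).
{ clear; intros a b l Hab H Hl.
  assert (Hg : is_RInt g a b (minus (G b) (G a)))
    by (apply (is_RInt_derive (V := R_CompleteNormedModule)); intros t Ht; apply H, Ht).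
  refine (norm_RInt_le f g a b l _ Hab _ Hl Hg).
  intros t Ht; apply H; rewrite Rmin_left, Rmax_right; assumption. }
intros H Hl; destruct (Rle_or_lt a b) as [Hab|Hab].
- eapply Rle_trans; [apply (W a b); assumption | apply Rle_abs].
- rewrite Rabs_minus_sym, <- norm_opp.
  eapply Rle_trans; [|apply Rle_abs].
  apply (W b a); [lra | | apply is_RInt_swap, Hl].
  intros t Ht; apply H; rewrite Rmin_comm, Rmax_comm; exact Ht.
Qed.

(* ln (t / (2 s)) <= t / (2 s) - 1 *)
Lemma power_exp_bound (s t : R) :
  0 < s -> 0 < t ->
  exp (s * ln t) * exp (- t) <= exp (s * ln (2 * s)) * exp (- t / 2).
Proof.
intros Hs Ht; rewrite <- !exp_plus; apply exp_le.
assert (H := exp_ineq1_le (ln (t / (2 * s)))).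
rewrite exp_ln, ln_div in H by (try apply Rdiv_lt_0_compat; lra).
apply Rmult_le_compat_l with (r := s) in H; [|lra].
replace (s * (t / (2 * s))) with (t / 2) in H by (field; lra).
lra.
Qed.

Lemma Bernoulli_le (n : nat) (u : R) :
  0 <= u <= 1 -> 1 - INR n * u <= (1 - u) ^ n.
Proof.
intros Hu; induction n as [|n IH]; [simpl; lra|].
rewrite S_INR; simpl.
apply Rmult_le_compat_l with (r := 1 - u) in IH; [|lra].
assert (H := pos_INR n).
assert (H2 : 0 <= INR n * (u * u)) by (apply Rmult_le_pos; [lra | nra]).
lra.
Qed.

Lemma exp_INR_mult (n : nat) (u : R) : exp (INR n * u) = exp u ^ n.
Proof.
induction n as [|n IH]; [simpl; rewrite Rmult_0_l; apply exp_0|].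
rewrite S_INR, Rmult_plus_distr_r, exp_plus, IH, Rmult_1_l; simpl; ring.
Qed.

(* exp t (1 - t/n)^n >= (1 + t/n)^n (1 - t/n)^n = (1 - t^2/n^2)^n >= 1 - t^2/n *)
Lemma exp_pow_approx (n : nat) (t : R) :
  (0 < n)%nat -> 0 <= t <= INR n ->
  0 <= exp (- t) - (1 - t / INR n) ^ n <= exp (- t) * (t * t / INR n).
Proof.
intros Hn Ht.
assert (Hn' : 0 < INR n) by (apply lt_0_INR, Hn).
set (u := t / INR n).
assert (Hu : 0 <= u <= 1).
{ unfold u; split.
  - unfold Rdiv; apply Rmult_le_pos; [lra | apply Rlt_le, Rinv_0_lt_compat, Hn'].
  - apply Rle_div_l; lra. }
assert (Et : t = INR n * u) by (unfold u; field; lra).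
assert (Em : exp (- t) = exp (- u) ^ n)
  by (rewrite <- exp_INR_mult; f_equal; rewrite Et; ring).
assert (Ep : exp t = exp u ^ n)
  by (rewrite <- exp_INR_mult; f_equal; exact Et).
split.
- assert (H : (1 - u) ^ n <= exp (- t)); [|lra].
  rewrite Em; apply pow_incr; split; [lra|].
  assert (H := exp_ineq1_le (- u)); lra.
- assert (H : 1 - t * t / INR n <= exp t * (1 - u) ^ n).
  { apply Rle_trans with ((1 - u * u) ^ n).
    - replace (t * t / INR n) with (INR n * (u * u))
        by (unfold u; field; lra).
      apply Bernoulli_le; nra.
    - replace (1 - u * u) with ((1 + u) * (1 - u)) by ring.
      rewrite Rpow_mult_distr, Ep.
      apply Rmult_le_compat_r; [apply pow_le; lra|].
      apply pow_incr; split; [lra | apply exp_ineq1_le]. }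
  apply Rmult_le_compat_l with (r := exp (- t)) in H;
    [|apply Rlt_le, exp_pos].
  rewrite <- Rmult_assoc, <- exp_plus, Rplus_opp_l, exp_0 in H; lra.
Qed.

(** * Convergence of the Gamma integral *)

Definition gamma_integrand (z : C) (t : R) : CV :=
  (Rcpower t (z - 1) * RtoC (exp (- t)))%C.

Lemma ex_RInt_gamma_integrand (z : C) (a b : R) :
  0 < a -> 0 < b -> ex_RInt (gamma_integrand z) a b.
Proof.
intros Ha Hb; apply ex_RInt_continuous; intros t Ht.
apply continuous_Rcpower_mult; [|auto_derive; exact I].
apply Rlt_le_trans with (2 := proj1 Ht), Rmin_glb_lt; assumption.
Qed.

Lemma Re_minus_1 (z : C) : Re (z - 1) = Re z - 1.
Proof. reflexivity. Qed.

(** Since e^(-t) <= 1, the integrand is dominated by t^(Re z - 1), whose primitive t^(Re z) / Re z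
    is positive and increasing. The bound is uniform in the endpoints and small with [d]. *)
Lemma gamma_integrand_near_0 (z : C) (d a b : R) (l : CV) :
  0 < Re z -> 0 < a < d -> 0 < b < d ->
  is_RInt (gamma_integrand z) a b l ->
  norm l <= exp (Re z * ln d) / Re z.
Proof.
intros Hz Ha Hb Hl.
set (G := fun t => exp (Re z * ln t) / Re z).
assert (HG : forall t, 0 < t < d -> 0 < G t < G d).
{ intros t Ht; unfold G; split.
  - apply Rdiv_lt_0_compat; [apply exp_pos | exact Hz].
  - apply Rmult_lt_compat_r; [apply Rinv_0_lt_compat, Hz|].
    apply exp_increasing, Rmult_lt_compat_l; [exact Hz|].
    apply ln_increasing; lra. }
apply Rle_trans with (Rabs (G b - G a)).
- apply (is_RInt_norm_le_primitive (gamma_integrand z) G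
    (fun t => exp (Re z * ln t) / t) a b l); [|exact Hl].
  intros t Ht.
  assert (Ht0 : 0 < t)
    by (apply Rlt_le_trans with (2 := proj1 Ht), Rmin_glb_lt; lra).
  split; [|split].
  + rewrite norm_Cmod; unfold gamma_integrand.
    rewrite Cmod_Rcpower_mult, Re_minus_1.
    replace (exp (Re z * ln t) / t) with (exp ((Re z - 1) * ln t) * 1).
    * apply Rmult_le_compat_l; [apply Rlt_le, exp_pos|].
      rewrite Rabs_pos_eq by apply Rlt_le, exp_pos.
      rewrite <- exp_0; apply exp_le; lra.
    * unfold Rminus, Rdiv; rewrite Rmult_plus_distr_r, exp_plus.
      replace (-(1) * ln t) with (- ln t) by ring.
      rewrite exp_Ropp, exp_ln by exact Ht0; ring.
  + unfold G; auto_derive; [exact Ht0 | field; lra].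
  + apply (ex_derive_continuous (V := R_NormedModule)); auto_derive; lra.
- specialize (HG a Ha) as HGa; specialize (HG b Hb).
  fold (G d); apply Rabs_le; lra.
Qed.

Lemma is_derive_exp_half (K t : R) :
  is_derive (fun t => - (2 * K) * exp (- t / 2)) t (K * exp (- t / 2)).
Proof. auto_derive; [exact I | unfold Rdiv; field]. Qed.

Lemma continuous_exp_half (K t : R) : continuous (fun t => K * exp (- t / 2)) t.
Proof.
apply (ex_derive_continuous (V := R_NormedModule)); auto_derive; exact I.
Qed.

(** Both values of the primitive lie between -2K e^(-M/2) and 0. This bounds the integral of the
    majorant K e^(-t/2) between any two points beyond [M]. *)
Lemma exp_half_variation (K M a b : R) :
  0 <= K -> M <= a -> M <= b ->
  Rabs (- (2 * K) * exp (- b / 2) - - (2 * K) * exp (- a / 2))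
    <= 2 * K * exp (- M / 2).
Proof.
intros HK Ha Hb.
assert (H : forall t, M <= t ->
  0 <= 2 * K * exp (- t / 2) <= 2 * K * exp (- M / 2)).
{ intros t Ht; split.
  - apply Rmult_le_pos; [lra | apply Rlt_le, exp_pos].
  - apply Rmult_le_compat_l; [lra | apply exp_le; lra]. }
assert (H1 := H a Ha); assert (H2 := H b Hb).
apply Rabs_le; lra.
Qed.

(** For t >= 1, t^(Re z - 1) <= t^(Re z) whatever the sign of Re z - 1; [power_exp_bound] with s =
    Re z then gives the majorant K e^(-t/2). *)
Lemma gamma_integrand_near_infty (z : C) :
  0 < Re z ->
  exists K, 0 < K /\ forall (M a b : R) (l : CV),
    1 <= M -> M <= a -> M <= b ->
    is_RInt (gamma_integrand z) a b l -> norm l <= K * exp (- M / 2).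
Proof.
intros Hz; set (K := exp (Re z * ln (2 * Re z))).
assert (HK : 0 < K) by apply exp_pos.
exists (2 * K); split; [lra|].
intros M a b l HM Ha Hb Hl.
eapply Rle_trans; [|apply (exp_half_variation K M a b); lra].
apply (is_RInt_norm_le_primitive (gamma_integrand z)
  (fun t => - (2 * K) * exp (- t / 2)) (fun t => K * exp (- t / 2)) a b l);
  [|exact Hl].
intros t Ht.
assert (Ht0 : 1 <= t)
  by (apply Rle_trans with (2 := proj1 Ht), Rmin_glb; lra).
split; [|split; [apply is_derive_exp_half | apply continuous_exp_half]].
rewrite norm_Cmod; unfold gamma_integrand.
rewrite Cmod_Rcpower_mult, Re_minus_1.
rewrite Rabs_pos_eq by apply Rlt_le, exp_pos.
eapply Rle_trans; [|apply power_exp_bound; lra].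
apply Rmult_le_compat_r; [apply Rlt_le, exp_pos|].
assert (Hln : 0 <= ln t) by (rewrite <- ln_1; apply ln_le; lra).
apply exp_le; lra.
Qed.

Lemma exists_exp_small (s c eps : R) :
  0 < s -> 0 < c -> 0 < eps -> exists d, 0 < d /\ c * exp (s * ln d) < eps.
Proof.
intros Hs Hc He.
(* This [d] solves c d^s = eps/2. *)
exists (exp ((ln (eps / (2 * c))) / s)); split; [apply exp_pos|].
rewrite ln_exp.
replace (s * (ln (eps / (2 * c)) / s)) with (ln (eps / (2 * c)))
  by (field; lra).
rewrite exp_ln by (apply Rdiv_lt_0_compat; lra).
replace (c * (eps / (2 * c))) with (eps / 2) by (field; lra).
lra.
Qed.

Lemma exists_exp_half_small (c eps : R) :
  0 < c -> 0 < eps -> exists M, 1 <= M /\ c * exp (- M / 2) < eps.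
Proof.
intros Hc He.
(* [L] solves c e^(-L/2) = eps/2; the maximum with 1 meets the condition M >= 1 of the tail
   estimate. *)
set (L := - 2 * ln (eps / (2 * c))).
exists (Rmax 1 L); split; [apply Rmax_l|].
apply Rle_lt_trans with (c * exp (ln (eps / (2 * c)))).
- apply Rmult_le_compat_l; [lra|]; apply exp_le.
  assert (H := Rmax_r 1 L); unfold L in H at 1; lra.
- rewrite exp_ln by (apply Rdiv_lt_0_compat; lra).
  replace (c * (eps / (2 * c))) with (eps / 2) by (field; lra).
  lra.
Qed.

Lemma at_right_0_interval (d : R) :
  0 < d -> at_right 0 (fun t => 0 < t < d).
Proof.
intros Hd; exists (mkposreal d Hd); intros y Hy H0.
unfold ball in Hy; simpl in Hy; unfold AbsRing_ball, abs, minus, plus, opp in Hy.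
simpl in Hy; apply Rabs_def2 in Hy; lra.
Qed.

(** Cauchy criterion in a complete space: integrals over [a, b] and [a', b'] differ by one piece
    near 0 and one near infinity, each at most eps/2. *)
Lemma ex_RInt_gen_gamma (z : C) :
  0 < Re z -> exists l : CV,
    is_RInt_gen (gamma_integrand z) (at_right 0) (Rbar_locally p_infty) l.
Proof.
intros Hz.
(* The integral enters as a relation, so the criterion also asks that it exist and be unique for
   endpoints close to the limits; the inline argument proves this. *)
apply (proj1 (filterlimi_locally_cauchy (U := CV)
  (F := filter_prod (at_right 0) (Rbar_locally p_infty))
  (fun ab => is_RInt (gamma_integrand z) (fst ab) (snd ab))
  ltac:(apply Filter_prod with (fun t => 0 < t < 1) (fun t => 0 < t);
    [apply at_right_0_interval; lra | exists 0; auto |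
     intros a b Ha Hb; split;
     [apply ex_RInt_gamma_integrand; simpl; lra |
      intros y1 y2; apply is_RInt_eq]]))).
intros eps.
destruct (gamma_integrand_near_infty z Hz) as [K [HK Hinf]].
destruct (exists_exp_half_small K (eps / 2) HK) as [M [HM1 HM]];
  [apply is_pos_div_2|].
destruct (exists_exp_small (Re z) (/ Re z) (eps / 2) Hz) as [d [Hd Hd']];
  [apply Rinv_0_lt_compat, Hz | apply is_pos_div_2 |].
exists (fun ab => 0 < fst ab < d /\ M < snd ab); split.
{ apply Filter_prod with (fun t => 0 < t < d) (fun t => M < t).
  - apply at_right_0_interval, Hd.
  - exists M; auto.
  - intros a b Ha Hb; split; assumption. }
intros [a b] [a' b'] [Ha Hb] [Ha' Hb'] l l' Hl Hl'; simpl in *.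
destruct (ex_RInt_gamma_integrand z a' a) as [l0 H0]; [lra | lra |].
destruct (ex_RInt_gamma_integrand z b b') as [l1 H1]; [lra | lra |].
(* Chasles along a', a, b, b' gives l' = l0 + l + l1. *)
assert (HC := is_RInt_Chasles _ _ _ _ _ _ (is_RInt_Chasles _ _ _ _ _ _ H0 Hl) H1).
assert (E := is_RInt_eq _ _ _ _ _ Hl' HC).
apply (norm_compat1 (V := CV)).
change (@norm R_AbsRing CV (l' - l)%C < eps).
change (l' = (l0 + l + l1)%C) in E.
replace (l' - l)%C with (l0 + l1)%C by (rewrite E; ring).
assert (B0 := gamma_integrand_near_0 z d a' a l0 Hz Ha' Ha H0).
assert (B1 := Hinf M b b' l1 HM1 (Rlt_le _ _ Hb) (Rlt_le _ _ Hb') H1).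
rewrite norm_Cmod in B0, B1 |- *.
apply Rle_lt_trans with (1 := Cmod_triangle l0 l1).
unfold Rdiv in B0; lra.
Qed.

(** * Euler's limit formula *)

(** By [exp_pow_approx] the two integrands differ by at most t^(Re z + 1) e^(-t) / n, and
    [power_exp_bound] with s = Re z + 1 turns this into (K/n) e^(-t/2), of integral at most 2K/n.
    The bound does not depend on [a]. *)
Lemma euler_difference_bound (z : C) :
  0 < Re z ->
  exists K, 0 < K /\ forall (n : nat) (a : R) (l : CV),
    (0 < n)%nat -> 0 < a <= INR n ->
    is_RInt (gamma_integrand z) a (INR n) l ->
    Cmod (l - (euler_primitive (INR n) z n (INR n)
               - euler_primitive (INR n) z n a))%C <= K / INR n.
Proof.
intros Hz; set (s := Re z + 1); set (K := exp (s * ln (2 * s))).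
assert (HK : 0 < K) by apply exp_pos.
assert (Hs : 0 < s) by (unfold s; lra).
exists (2 * K); split; [lra|].
intros n a l Hn Ha Hl.
assert (Hn' : 0 < INR n) by (apply lt_0_INR, Hn).
assert (HP : is_RInt (V := CV)
  (fun t => Rcpower t (z - 1) * RtoC ((1 - t / INR n) ^ n))%C a (INR n)
  (minus (G := CV) (euler_primitive (INR n) z n (INR n))
         (euler_primitive (INR n) z n a))).
{ apply (is_RInt_derive (V := CV)); rewrite Rmin_left by lra;
    intros t Ht.
  - apply is_derive_euler_primitive; lra.
  - apply continuous_Rcpower_mult; [lra | auto_derive; exact I]. }
assert (HD := is_RInt_minus _ _ _ _ _ _ Hl HP).
change (Cmod (l - (euler_primitive (INR n) z n (INR n)
               - euler_primitive (INR n) z n a))%C) with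
  (Cmod (minus (G := CV) l (minus (G := CV)
    (euler_primitive (INR n) z n (INR n)) (euler_primitive (INR n) z n a)))).
rewrite <- norm_Cmod.
assert (HKn : 0 < K / INR n) by (apply Rdiv_lt_0_compat; assumption).
(* This is the variation bound with M = 0, where the exponential factor is 1. *)
apply Rle_trans with (2 * (K / INR n) * exp (- 0 / 2)).
2: { right; replace (- 0 / 2) with 0 by field; rewrite exp_0; field; lra. }
eapply Rle_trans;
  [|apply (exp_half_variation (K / INR n) 0 a (INR n)); lra].
refine (is_RInt_norm_le_primitive _
  (fun t => - (2 * (K / INR n)) * exp (- t / 2))
  (fun t => K / INR n * exp (- t / 2)) a (INR n) _ _ HD).
rewrite Rmin_left, Rmax_right by lra; intros t Ht.
split; [|split; [apply is_derive_exp_half | apply continuous_exp_half]].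
rewrite norm_Cmod.
replace (minus _ _) with
  (Rcpower t (z - 1) * RtoC (exp (- t) - (1 - t / INR n) ^ n))%C.
2: { unfold gamma_integrand; rewrite RtoC_minus.
     transitivity (Rcpower t (z - 1) * RtoC (exp (- t))
       - Rcpower t (z - 1) * RtoC ((1 - t / INR n) ^ n))%C; [ring | reflexivity]. }
rewrite Cmod_Rcpower_mult, Re_minus_1.
destruct (exp_pow_approx n t Hn) as [H1 H2]; [lra|].
rewrite Rabs_pos_eq by exact H1.
eapply Rle_trans;
  [apply Rmult_le_compat_l; [apply Rlt_le, exp_pos | exact H2]|].
assert (E : exp ((Re z - 1) * ln t) * (t * t) = exp (s * ln t)).
{ rewrite <- (exp_ln t) at 2 3 by lra; rewrite <- !exp_plus.
  f_equal; unfold s; ring. }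
replace (exp ((Re z - 1) * ln t) * (exp (- t) * (t * t / INR n))) with
  (exp (s * ln t) * exp (- t) / INR n) by (rewrite <- E; field; lra).
replace (K / INR n * exp (- t / 2)) with (K * exp (- t / 2) / INR n)
  by (field; lra).
apply Rmult_le_compat_r; [apply Rlt_le, Rinv_0_lt_compat, Hn'|].
apply power_exp_bound; lra.
Qed.

Lemma eventually_INR_gt (M : R) : eventually (fun n => M < INR n).
Proof.
assert (H := is_lim_seq_INR); apply is_lim_seq_spec in H; exact (H M).
Qed.

(** Let F be the primitive for N = j = n. Then F(n) - Gamma(z) is the sum of F(a), the error of
    truncating the Gamma integral to [a, n], and minus the error of replacing e^(-t) by (1 - t/n)^n
    there. Each is made smaller than eps/3, fixing first n and then a. *)
Lemma euler_limit_CGamma (z : C) :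
  0 < Re z ->
  is_Clim_seq (fun n => RtoC (INR (fact n)) * Rcpower (INR n) z
    / Cprod (fun i => z + RtoC (INR i)) (S n))%C (CGamma z).
Proof.
intros Hz.
destruct (ex_RInt_gen_gamma z Hz) as [l Hl].
replace (CGamma z) with (l : C)
  by (symmetry; exact (is_RInt_gen_unique (V := CV) _ _ Hl)).
destruct (euler_difference_bound z Hz) as [K [HK HD]].
apply is_Clim_seq_eps; intros eps.
assert (He := cond_pos eps).
assert (He3 : 0 < eps / 3) by lra.
apply (filterlimi_filter_le_2 (U := CV) _
  (H := locally_norm l) (locally_le_locally_norm l)) in Hl.
specialize (Hl _ (locally_norm_ball_norm l (mkposreal _ He3))).
destruct Hl as [P Q [d HP] [M HQ] HPQ].
(* The threshold 3K/eps yields K/n < eps/3, and also n > 0. *)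
generalize (filter_and _ _ (eventually_INR_gt M)
  (eventually_INR_gt (3 * K / eps))).
apply filter_imp; intros n [HnM HnK].
assert (Hn' : 0 < INR n).
{ apply Rlt_trans with (2 := HnK), Rdiv_lt_0_compat; lra. }
assert (Hn : (0 < n)%nat) by (apply INR_lt; exact Hn').
rewrite <- euler_primitive_end by assumption.
destruct (euler_primitive_bound (INR n) z n Hn' Hz) as [B [HB HBn]].
(* [B] may be 0, while a positive constant is required; hence [B + 1]. *)
destruct (exists_exp_small (Re z) (B + 1) (eps / 3) Hz) as [d' [Hd' Hs]];
  [lra | lra |].
(* Below [d] the truncation error is controlled, below [d'] the value F(a) is small, and a <= n
   makes [a, n] an interval. *)
set (a := Rmin (Rmin d d' / 2) (INR n)).
assert (Hdd : 0 < Rmin d d') by (apply Rmin_glb_lt; [apply cond_pos | exact Hd']).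
assert (Ha0 : 0 < a) by (apply Rmin_glb_lt; lra).
assert (Ha1 : a < Rmin d d')
  by (apply Rle_lt_trans with (Rmin d d' / 2); [apply Rmin_l | lra]).
assert (Had := Rmin_l d d'); assert (Had' := Rmin_r d d').
assert (Han : a <= INR n) by apply Rmin_r.
assert (HPa : P a).
{ apply HP; [|exact Ha0].
  unfold ball; simpl; unfold AbsRing_ball, abs, minus, plus, opp; simpl.
  apply Rabs_def1; lra. }
destruct (HPQ a (INR n) HPa (HQ _ HnM)) as [y [Hy Hyl]].
unfold ball_norm in Hyl; rewrite norm_Cmod in Hyl; simpl in Hy, Hyl.
change (Cmod (y - l)%C < eps / 3) in Hyl.
assert (D1 := HD n a y Hn (conj Ha0 Han) Hy).
assert (D2 := HBn a (conj Ha0 Han)).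
assert (D2' : exp (Re z * ln a) <= exp (Re z * ln d')).
{ apply exp_le, Rmult_le_compat_l; [lra | apply ln_le; lra]. }
assert (D3 : K / INR n < eps / 3).
{ apply Rlt_div_l; [exact Hn'|].
  apply Rlt_div_l in HnK; [lra | exact He]. }
set (u := euler_primitive (INR n) z n (INR n)) in *.
set (v := euler_primitive (INR n) z n a) in *.
replace (u - l)%C with (v + ((y - l) + - (y - (u - v))))%C by ring.
eapply Rle_lt_trans; [apply Cmod_triangle|].
apply Rle_lt_trans with
  (Cmod v + (Cmod (y - l) + Cmod (y - (u - v))))%R.
- apply Rplus_le_compat_l.
  rewrite <- (Cmod_opp (y - (u - v))); apply Cmod_triangle.
- assert (B * exp (Re z * ln a) < eps / 3); [|lra].
  apply Rle_lt_trans with (2 := Hs).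
  apply Rmult_le_compat; [lra | apply Rlt_le, exp_pos | lra | exact D2'].
Qed.

(** * Scaling to the p-k and k sequences *)

Local Open Scope C_scope.

Lemma Cprod_scal (c : C) (u v : nat -> C) (n : nat) :
  (forall i, v i = c * u i) -> Cprod v n = Cpow c n * Cprod u n.
Proof.
intros H; induction n as [|n IH]; simpl; [ring|].
rewrite IH, H; ring.
Qed.

(** The n+1 factors of the Pochhammer symbol release p^(n+1), which cancels the numerator exactly;
    (np)^z = n^z p^z leaves p^z times Euler's term, with z = x/k. *)
Lemma pkGamma_seq_CGamma (p k : R) (x : C) :
  (0 < p)%R -> (0 < k)%R -> (0 < Re (x / RtoC k))%R ->
  is_Clim_seq (pkGamma_seq p k x)
    (Rcpower p (x / RtoC k) * CGamma (x / RtoC k)).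
Proof.
intros Hp Hk Hz.
(* The constant factor 1 serves to transfer the limit along an equality valid for n > 0 only, as
   splitting (np)^z needs a positive base. *)
refine (is_Clim_seq_mult_1 _ (fun _ => 1) _ _ _
  (is_Clim_seq_scal (Rcpower p (x / RtoC k)) _ _ (euler_limit_CGamma _ Hz)) _).
2: { intros P HP; exists O; intros n _; apply locally_singleton, HP. }
intros n Hn.
assert (Hn' : (0 < INR n)%R) by (apply lt_0_INR; exact Hn).
assert (Hk0 := RtoC_neq_0 k Hk); assert (Hp0 := RtoC_neq_0 p Hp).
unfold pkGamma_seq, pk_pochhammer.
rewrite (Cprod_scal (RtoC p) (fun i => x / RtoC k + RtoC (INR i)))
  by (intros i; rewrite RtoC_mult; field; exact Hk0).
rewrite Rcpower_mult_base, RtoC_mult, RtoC_pow, Nat.add_1_r by assumption.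
field; split.
- exact (Cprod_neq_0 _ (S n) (fun i => Cplus_INR_neq_0 _ i Hz)).
- apply Cpow_nz, Hp0.
Qed.

(** Here the product stops one factor earlier and the exponent is z - 1, so relative to k^(z-1)
    times Euler's term there is an extra factor (z+n)/n = 1 + z/n, which tends to 1. *)
Lemma kGamma_seq_CGamma (k : R) (x : C) :
  (0 < k)%R -> (0 < Re (x / RtoC k))%R ->
  is_Clim_seq (kGamma_seq k x)
    (Rcpower k (x / RtoC k - 1) * CGamma (x / RtoC k)).
Proof.
intros Hk Hz.
refine (is_Clim_seq_mult_1 _ _ _ _ _
  (is_Clim_seq_scal (Rcpower k (x / RtoC k - 1)) _ _ (euler_limit_CGamma _ Hz))
  (is_Clim_seq_1_div (x / RtoC k))).
intros n Hn.
assert (Hn' : (0 < INR n)%R) by (apply lt_0_INR; exact Hn).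
assert (Hk0 := RtoC_neq_0 k Hk); assert (Hn0 := RtoC_neq_0 _ Hn').
unfold kGamma_seq, k_pochhammer.
rewrite (Cprod_scal (RtoC k) (fun i => x / RtoC k + RtoC (INR i)))
  by (intros i; rewrite RtoC_mult; field; exact Hk0).
rewrite Rcpower_mult_base, RtoC_mult, RtoC_pow by assumption.
rewrite (Rcpower_minus_1 (INR n)), RtoC_inv by (assumption || lra).
assert (HQ := Cprod_neq_0 _ n (fun i => Cplus_INR_neq_0 _ i Hz)).
assert (HS := Cplus_INR_neq_0 _ n Hz).
simpl Cprod.
set (Q := Cprod _ n) in *; set (z := x / RtoC k) in *.
field; repeat split; try assumption; apply Cpow_nz, Hk0.
Qed.

(** Both limits are known multiples of Gamma(x/k), which leaves only algebra of powers. The two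
    existence clauses give content to the equations, since [Clim_seq] is unspecified on divergent
    sequences. *)
Theorem theorem2p9 (k p : R) (x : C)
  (hk : (0 < k)%R) (hp : (0 < p)%R)
  (hx : forall m : Z, (m < 0)%Z -> x <> RtoC (k * IZR m))
  (hRe : (0 < Re x)%R) :
  ex_Clim_seq (pkGamma_seq p k x) /\
  ex_Clim_seq (kGamma_seq k x) /\
  pkGamma p k x = (Rcpower (p / k) (x / RtoC k) * kGamma k x)%C /\
  (Rcpower (p / k) (x / RtoC k) * kGamma k x)%C =
    (Rcpower p (x / RtoC k) / RtoC k * CGamma (x / RtoC k))%C.
Proof.
assert (Hz : (0 < Re (x / RtoC k))%R).
{ unfold Cdiv; rewrite <- RtoC_inv by lra.
  destruct x as [a b]; simpl in hRe |- *.
  replace (a * / k - b * 0)%R with (a / k)%R by (unfold Rdiv; ring).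
  apply Rdiv_lt_0_compat; assumption. }
assert (Hpk := pkGamma_seq_CGamma p k x hp hk Hz).
assert (HkG := kGamma_seq_CGamma k x hk Hz).
assert (E : Rcpower (p / k) (x / RtoC k) * kGamma k x
  = Rcpower p (x / RtoC k) / RtoC k * CGamma (x / RtoC k)).
{ unfold kGamma; rewrite (is_Clim_seq_unique _ _ HkG).
  rewrite Rcpower_minus_1 by exact hk.
  (* Only the right-hand p is rewritten: p^z = (p/k)^z k^z then matches the factor k^z / k coming
     from the limit of [kGamma_seq]. *)
  replace p with (p / k * k)%R at 2 by (field; lra).
  rewrite Rcpower_mult_base
    by (try exact hk; apply Rdiv_lt_0_compat; assumption).
  field; apply RtoC_neq_0, hk. }
split; [eexists; exact Hpk|].
split; [eexists; exact HkG|].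
split; [|exact E].
rewrite E; unfold pkGamma; rewrite (is_Clim_seq_unique _ _ Hpk).
field; apply RtoC_neq_0, hk.
Qed.
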